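(* Let $B$ be a commutative unital $k$-algebra over a commutative Noetherian ring $k$, let $n>0$ and $\psi\in M_n(B)$. Let $J:=(M_n(B),\psi)$ be the generalised matrix ring, with multiplication $a*b=a\psi b$, and let $I=\langle\psi_{ij}\mid1\le i,j\le n\rangle$ be the ideal of $B$ generated by the entries of $\psi$. (1) $J$ satisfies the monic polynomial identity $s_{2n}^2$. (2) $J$ is a semiprime ring if and only if $B$ is reduced and $\det(\psi)$ is not a zero divisor in $B$. (3) The adjoint (adjugate) matrix $\psi^+$ of $\psi$ is a central element in $J$. (4) If $\det(\psi)$ is not a zero divisor in $B$, then $\mathrm{End}({}_JJ)\simeq M_n(B)$. (5) $J*J=\sum_{i,j=1}^nJ*E_{ij}=M_n(I)$. (6) $J$ is idempotent (i.e. $J*J=J$) if and only if $I=B$. In this case (i) $J$ is a finitely generated left $J$-module; (ii) $\mathrm{End}({}_JJ)\simeq M_n(B)$; and (iii) $\mathrm{End}({}_J\Delta)\simeq B$, where $\Delta=\bigoplus_{j=1}^nBE_{j1}$. (7) The following are equivalent: $J$ is generated as a left ideal over itself by an idempotent; $J$ is generated as a left ideal over itself by a central idempotent; $J$ is a cyclic left $J$-module; $\det(\psi)$ is invertible in $B$.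
   Context: $E_{ij}$ are the matrix units of $M_n(B)$. The standard polynomial is $s_r=\sum_{\sigma\in S_r}\mathrm{sgn}(\sigma)x_{\sigma(1)}\cdots x_{\sigma(r)}$ in non-commuting variables. A ring satisfies a polynomial identity $f$ if $f$ vanishes under all substitutions of ring elements; $f$ is monic if at least one of its words of highest degree has coefficient $1$. A ring is semiprime if it has no non-zero nilpotent ideal. $J*J$ and $J*E_{ij}$ denote the additive subgroups generated by the respective products. $J$ is in general non-unital; ''$J$ is generated as a left ideal by $e$'', respectively ''$J$ is cyclic with generator $e$'', means $J=J*e$ with $e\in J$, and ''finitely generated left $J$-module'' means $J=\sum_tJ*x_t$ for finitely many $x_t\in J$. Products in endomorphism rings of left modules are formed by applying the left factor first, so that right multiplication gives a ring homomorphism. *)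

(* Defs.v *)
From HB Require Import structures.
From mathcomp Require Import all_boot all_order all_algebra all_fingroup.
From mathcomp Require Import boolp classical_sets.
From mathcomp Require Import finmap.
From mathcomp.multinomials Require Import monalg.

Set Implicit Arguments.
Unset Strict Implicit.
Unset Printing Implicit Defensive.

Import GRing.Theory.
Local Open Scope classical_set_scope.
Local Open Scope ring_scope.

Section CommutativeRings.
Context (B : comPzRingType).

Definition ideal_set (A : set B) : Prop :=
  [/\ A 0, forall x y, A x -> A y -> A (x + y) & forall b x, A x -> A (b * x)].

Definition ideal_gen (G : set B) : set B := smallest ideal_set G.

Definition noetherian : Prop :=
  forall A : set B, ideal_set A -> exists s : seq B, A = ideal_gen [set` s].

Definition reduced : Prop := forall (b : B) (m : nat), b ^+ m = 0 -> b = 0.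

Definition zero_divisor (a : B) : Prop := exists2 b : B, b != 0 & a * b = 0.

Definition invertible (a : B) : Prop := exists b : B, a * b = 1.

Definition entries_ideal n (psi : 'M[B]_n) : set B :=
  ideal_gen [set psi ij.1 ij.2 | ij in [set: 'I_n * 'I_n]].

End CommutativeRings.

Section AdditiveSubgroups.
Context (V : zmodType).

Definition addsubgroup (A : set V) : Prop :=
  A 0 /\ forall x y, A x -> A y -> A (x - y).

Definition addspan (G : set V) : set V := smallest addsubgroup G.

Definition addsum (T : Type) (D : set T) (A : T -> set V) : set V :=
  addspan (\bigcup_(t in D) A t).

End AdditiveSubgroups.

(* Rings that need not have a unit. *)
HB.mixin Record Zmodule_isRng R of GRing.Zmodule R := {
  rngmul : R -> R -> R;
  rngmulA : associative rngmul;
  rngmulDl : left_distributive rngmul +%R;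
  rngmulDr : right_distributive rngmul +%R
}.

#[short(type="rngType")]
HB.structure Definition Rng := { R of Zmodule_isRng R & GRing.Zmodule R }.

Notation "a ** b" := (rngmul a b) (at level 40, left associativity) : ring_scope.

Section RngTheory.
Context (R : rngType).

Definition idempotent_elt (e : R) : Prop := e ** e = e.

Definition central (z : R) : Prop := forall a : R, a ** z = z ** a.

Definition rng_setmul (A C : set R) : set R :=
  addspan [set a ** c | a in A & c in C].

Definition left_multiples (x : R) : set R := rng_setmul setT [set x].

Definition left_generator (e : R) : Prop := left_multiples e = setT.

Definition left_finitely_generated : Prop :=
  exists s : seq R, addsum [set` s] left_multiples = setT.

Definition idempotent_rng : Prop :=
  rng_setmul [set: R] [set: R] = setT.

Definition rng_ideal (A : set R) : Prop :=
  addsubgroup A /\ forall a x, A x -> A (a ** x) /\ A (x ** a).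

(* [iter m (rng_setmul A) A] is the power A ^ (m + 1). *)
Definition nilpotent_set (A : set R) : Prop :=
  exists m : nat, iter m (rng_setmul A) A = [set 0].

Definition semiprime : Prop :=
  forall A : set R, rng_ideal A -> nilpotent_set A -> A = [set 0].

End RngTheory.

(* Polynomials with integer coefficients in non-commuting variables x_0, x_1,  *)
(* ...: the monoid algebra of the free monoid on nat.                          *)
Notation ncpoly := {malg int[{fmonom nat}]}.

Definition ncvar (i : nat) : ncpoly := << 1%R *g fmu i >>.

Definition standard_poly (r : nat) : ncpoly :=
  \sum_(sigma : 'S_r) (-1) ^+ sigma * \prod_(i < r) ncvar (sigma i).

Definition monic_ncpoly (f : ncpoly) : Prop :=
  exists w : {fmonom nat},
    [/\ w \in msupp f, forall u, u \in msupp f -> (fdeg u <= fdeg w)%N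
      & f@_w = 1].

Section Identities.
Context (R : rngType).

(* The empty word has no value in a ring without unit; the value 0 given to    *)
(* it is never used, as [satisfies] only admits f without constant term.       *)
Definition eval_word (v : nat -> R) (w : seq nat) : R :=
  if w is i :: w' then foldl (fun a j => a ** v j) (v i) w' else 0.

Definition eval_ncpoly (v : nat -> R) (f : ncpoly) : R :=
  \sum_(w <- msupp f) eval_word v w *~ f@_w.

Definition satisfies (f : ncpoly) : Prop :=
  f@_(fmone nat) = 0 /\ forall v : nat -> R, eval_ncpoly v f = 0.

End Identities.

HB.mixin Record Zmodule_isRngModule (R : rngType) M of GRing.Zmodule M := {
  rngact : R -> M -> M;
  rngactA : forall a b x, rngact (a ** b) x = rngact a (rngact b x);
  rngactDl : forall a b x, rngact (a + b) x = rngact a x + rngact b x;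
  rngactDr : forall a x y, rngact a (x + y) = rngact a x + rngact a y
}.

#[short(type="rngModType")]
HB.structure Definition RngModule (R : rngType) :=
  { M of Zmodule_isRngModule R M & GRing.Zmodule M }.

Section Endomorphisms.
Context (R : rngType) (M : rngModType R).

Definition rng_linear (f : M -> M) : Prop :=
  (forall x y, f (x + y) = f x + f y) /\
  (forall (a : R) x, f (rngact a x) = rngact a (f x)).

Record rngEnd := RngEnd {
  rngEnd_fun :> M -> M;
  rngEndP : rng_linear rngEnd_fun
}.

Lemma rngEnd_ext (f g : rngEnd) : (forall x, f x = g x) -> f = g.
Proof.
case: f => f Pf; case: g => g Pg /= /funext fg; case: _ / fg in Pg *.
by rewrite (Prop_irrelevance Pf Pg).
Qed.

HB.instance Definition _ := gen_eqMixin rngEnd.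
HB.instance Definition _ := gen_choiceMixin rngEnd.

Lemma rngact0 (a : R) : rngact a (0 : M) = 0.
Proof. by apply: (addrI (rngact a 0)); rewrite -rngactDr !addr0. Qed.

Lemma rngactN (a : R) (x : M) : rngact a (- x) = - rngact a x.
Proof. by apply/eqP; rewrite -addr_eq0 -rngactDr addNr rngact0. Qed.

Fact rngEnd_zero_proof : rng_linear (fun _ : M => 0).
Proof. by split=> [x y|a x]; rewrite ?addr0 ?rngact0. Qed.
Definition rngEnd_zero := RngEnd rngEnd_zero_proof.

Fact rngEnd_opp_proof (f : rngEnd) : rng_linear (fun x => - f x).
Proof.
case: f => f [fD fZ]; split=> [x y|a x] /=; first by rewrite fD opprD.
by rewrite fZ rngactN.
Qed.
Definition rngEnd_opp f := RngEnd (rngEnd_opp_proof f).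

Fact rngEnd_add_proof (f g : rngEnd) : rng_linear (fun x => f x + g x).
Proof.
case: f => f [fD fZ]; case: g => g [gD gZ]; split=> [x y|a x] /=.
  by rewrite fD gD addrACA.
by rewrite fZ gZ rngactDr.
Qed.
Definition rngEnd_add f g := RngEnd (rngEnd_add_proof f g).

Fact rngEnd_one_proof : rng_linear (fun x : M => x).
Proof. by split. Qed.
Definition rngEnd_one := RngEnd rngEnd_one_proof.

Fact rngEnd_mul_proof (f g : rngEnd) : rng_linear (fun x => g (f x)).
Proof.
case: f => f [fD fZ]; case: g => g [gD gZ]; split=> [x y|a x] /=.
  by rewrite fD gD.
by rewrite fZ gZ.
Qed.
(* The left factor of a product is applied first. *)
Definition rngEnd_mul f g := RngEnd (rngEnd_mul_proof f g).

Fact rngEnd_addA : associative rngEnd_add.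
Proof. by move=> f g h; apply: rngEnd_ext => x /=; rewrite addrA. Qed.
Fact rngEnd_addC : commutative rngEnd_add.
Proof. by move=> f g; apply: rngEnd_ext => x /=; rewrite addrC. Qed.
Fact rngEnd_add0 : left_id rngEnd_zero rngEnd_add.
Proof. by move=> f; apply: rngEnd_ext => x /=; rewrite add0r. Qed.
Fact rngEnd_addN : left_inverse rngEnd_zero rngEnd_opp rngEnd_add.
Proof. by move=> f; apply: rngEnd_ext => x /=; rewrite addNr. Qed.

HB.instance Definition _ := GRing.isZmodule.Build rngEnd
  rngEnd_addA rngEnd_addC rngEnd_add0 rngEnd_addN.

Fact rngEnd_mulA : associative rngEnd_mul.
Proof. by move=> f g h; apply: rngEnd_ext. Qed.
Fact rngEnd_mul1l : left_id rngEnd_one rngEnd_mul.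
Proof. by move=> f; apply: rngEnd_ext. Qed.
Fact rngEnd_mul1r : right_id rngEnd_one rngEnd_mul.
Proof. by move=> f; apply: rngEnd_ext. Qed.
Fact rngEnd_mulDl : left_distributive rngEnd_mul +%R.
Proof. by move=> f g [h [hD hZ]]; apply: rngEnd_ext => x /=; apply: hD. Qed.
Fact rngEnd_mulDr : right_distributive rngEnd_mul +%R.
Proof. by move=> f g h; apply: rngEnd_ext. Qed.

HB.instance Definition _ := GRing.Zmodule_isPzRing.Build rngEnd
  rngEnd_mulA rngEnd_mul1l rngEnd_mul1r rngEnd_mulDl rngEnd_mulDr.

End Endomorphisms.

Definition ring_isomorphic (R S : pzRingType) : Prop :=
  exists f : {rmorphism R -> S}, bijective f.

(* R as a left module over itself. *)
Definition rng_regular (R : rngType) : Type := R.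

Section RegularModule.
Context (R : rngType).
HB.instance Definition _ := GRing.Zmodule.on (rng_regular R).
HB.instance Definition _ := Zmodule_isRngModule.Build R (rng_regular R)
  (fun a b x => esym (rngmulA a b x)) (@rngmulDl R) (@rngmulDr R).
End RegularModule.

Definition gmatrix (B : comPzRingType) n (psi : 'M[B]_n) : Type := 'M[B]_n.

Section GeneralisedMatrixRing.
Context (B : comPzRingType) (n : nat) (psi : 'M[B]_n).
Local Notation J := (gmatrix psi).

HB.instance Definition _ := GRing.Zmodule.on J.

Definition gmatrix_mul (a b : J) : J := a *m psi *m b.

Fact gmatrix_mulA : associative gmatrix_mul.
Proof. by move=> a b c; rewrite /gmatrix_mul !mulmxA. Qed.
Fact gmatrix_mulDl : left_distributive gmatrix_mul +%R.
Proof. by move=> a b c; rewrite /gmatrix_mul !mulmxDl. Qed.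
Fact gmatrix_mulDr : right_distributive gmatrix_mul +%R.
Proof. by move=> a b c; rewrite /gmatrix_mul mulmxDr. Qed.

HB.instance Definition _ := Zmodule_isRng.Build J
  gmatrix_mulA gmatrix_mulDl gmatrix_mulDr.

Definition matrix_unit (i j : 'I_n) : J := delta_mx i j.

Definition matrices_over (A : set B) : set J :=
  [set a : 'M[B]_n | forall i j, A (a i j)].

(* The left J-module \bigoplus_i B E_(i, j0). *)
Section ColumnModule.
Context (j0 : 'I_n).

Definition in_column (a : 'M[B]_n) : Prop :=
  exists b : 'I_n -> B, a = \sum_i b i *: delta_mx i j0.

Definition column_pred : {pred J} := fun a => `[< in_column a >].

Record column_module := ColumnModule {
  column_val :> J;
  column_valP : column_val \in column_pred
}.

HB.instance Definition _ := [isSub for column_val].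
HB.instance Definition _ := [Choice of column_module by <:].

Fact in_column_zmod : zmod_closed column_pred.
Proof.
split=> [|x y]; rewrite !unfold_in.
  by apply/asboolP; exists (fun=> 0); rewrite big1 // => i _; rewrite scale0r.
move=> /asboolP[b ->] /asboolP[c ->]; apply/asboolP; exists (fun i => b i - c i).
by rewrite -sumrB; apply: eq_bigr => i _; rewrite scalerBl.
Qed.

HB.instance Definition _ := GRing.isZmodClosed.Build J column_pred
  in_column_zmod.
HB.instance Definition _ := [SubChoice_isSubZmodule of column_module by <:].

Fact in_column_entry (b : 'I_n -> B) i j :
  (\sum_l b l *: (delta_mx l j0 : 'M[B]_n)) i j = b i *+ (j == j0).
Proof.
rewrite summxE (bigD1 i) //= [X in _ + X]big1 ?addr0 => [|l li].
  by rewrite !mxE eqxx /= mulr_natr.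
by rewrite !mxE eq_sym (negPf li) mulr0.
Qed.

Fact column_act_proof (a : J) (x : column_module) :
  a ** column_val x \in column_pred.
Proof.
case: x => x /= /asboolP[b xE]; apply/asboolP.
exists (fun i => \sum_l (a *m psi) i l * b l).
apply/matrixP => i j; rewrite [_ ** _](_ : _ = a *m psi *m x) // xE.
rewrite in_column_entry mxE -sumrMnl; apply: eq_bigr => l _.
by rewrite in_column_entry mulrnAr.
Qed.
Definition column_act (a : J) (x : column_module) : column_module :=
  ColumnModule (column_act_proof a x).

Fact column_actA a b x :
  column_act (a ** b) x = column_act a (column_act b x).
Proof. by apply: val_inj; rewrite /= rngmulA. Qed.
Fact column_actDl a b x :
  column_act (a + b) x = column_act a x + column_act b x.
Proof. by apply: val_inj; rewrite /= rngmulDl. Qed.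
Fact column_actDr a x y :
  column_act a (x + y) = column_act a x + column_act a y.
Proof. by apply: val_inj; rewrite /= rngmulDr. Qed.

HB.instance Definition _ := Zmodule_isRngModule.Build J column_module
  column_actA column_actDl column_actDr.

End ColumnModule.
End GeneralisedMatrixRing.

(* Main.v *)
Require Import Defs.
From HB Require Import structures.
From mathcomp Require Import all_boot all_order all_algebra all_fingroup.
From mathcomp Require Import boolp classical_sets.
From mathcomp Require Import finmap.
From mathcomp.multinomials Require Import monalg.
From mathcomp Require Import zify.

Set Implicit Arguments.
Unset Strict Implicit.
Unset Printing Implicit Defensive.

Import GRing.Theory.
Local Open Scope classical_set_scope.
Local Open Scope ring_scope.

(** Everything rests on the relation [psi *m \adj psi = \adj psi *m psi = d],
    with d the determinant of psi, and on the ring homomorphism a |-> a psi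
    from J to M_n(B).

    The identity: a |-> a psi sends s_2n(v) to s_2n(v psi), which is 0 by the
    theorem of Amitsur and Levitzki ([amitsur_levitzki]); so s_2n(v) psi = 0,
    and s_2n(v) * s_2n(v) = s_2n(v) psi s_2n(v) = 0.  The theorem of Amitsur
    and Levitzki is proved by Rosset's method.  By multilinearity it suffices
    to treat integer matrices a_i.  Put A = \sum_i a_i e_i with anticommuting
    e_1, ..., e_2n.  The entries of A^2 commute with one another, while the
    cyclicity of the trace and the anticommutation give tr(A^2m) = 0 for
    m > 0.  In the absence of torsion this forces A^2n = (A^2)^n = 0
    ([nilpotent_mx_of_trace]).  But A^2n is s_2n(a) times the product of the
    e_i ([standard_sum_expand]), and that product is not zero.

    Semiprimeness: b J is a nilpotent ideal for b nilpotent in B, and the a with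
    psi a psi = 0 form an ideal whose cube is 0.  If d is a zero divisor, a
    column killed by psi exists by McCoy's theorem ([mccoy_kernel]), so that
    ideal is not 0.  Conversely, an ideal containing a contains c \adj psi for c = d^2 a_pq, and the powers of this
    element are c^(m+1) d^m \adj psi; when one of them vanishes, c d is
    nilpotent, and reducedness and regularity of d give a_pq = 0.

    Endomorphisms: an additive J-linear f is determined on products,
    f(y * z) = y psi f(z).  If d is regular, d x = (x \adj psi) * 1 reduces
    f(x) to f(1).  If J is idempotent, 1 = \sum_t y_t psi z_t for suitable
    y_t, z_t; then x = \sum_t (x y_t) * z_t shows both that the z_t generate J
    and that f(x) = x C with C = \sum_t y_t psi f(z_t).  In both cases f is
    the right multiplication by f(1).  The same computation on a column,
    where only the corner of C matters, gives End(Delta) = B.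

    The matrices over the ideal of the entries of psi are products in J since
    b psi_pq E_ij = (b E_ip) * E_qj.  Finally, J = J * e makes 1 = a psi e for
    some a, hence d invertible, while for d invertible the inverse of psi is a
    unit element of J. *)

(** * Matrices whose powers have trace zero *)

Definition torsion_free (V : zmodType) :=
  forall (x : V) m, x *+ m.+1 = 0 -> x = 0.

Lemma deriv_prod (S : comNzRingType) (I : finType) (F : I -> {poly S}) :
  (\prod_i F i)^`() = \sum_i (F i)^`() * \prod_(k | i != k) F k.
Proof.
have: uniq (index_enum I) by exact: index_enum_uniq.
elim: (index_enum I) => [|x r IHr] /=; first by rewrite !big_nil derivC.
case/andP=> xr ur; rewrite !big_cons derivM IHr // eqxx /=; congr (_ * _ + _).
  rewrite big_seq [RHS]big_seq_cond; apply: eq_bigl => k.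
  by case: eqVneq => [<-|]; rewrite ?andbT ?(negPf xr).
rewrite big_distrr /= big_seq [RHS]big_seq; apply: eq_bigr => i ir.
by rewrite big_cons mulrCA; case: eqVneq ir => // ->; rewrite (negPf xr).
Qed.

Lemma deriv_det (S : comNzRingType) n (P : 'M[{poly S}]_n) :
  (\det P)^`() = \sum_i \sum_j (P i j)^`() * cofactor P i j.
Proof.
rewrite raddf_sum /=.
transitivity (\sum_(s : 'S_n) \sum_i
    (P i (s i))^`() * ((-1) ^+ s * \prod_(k | i != k) P k (s k))).
  apply: eq_bigr => s _.
  have sgnE : ((-1) ^+ s : {poly S}) = ((-1) ^+ s)%:P by rewrite rmorph_sign.
  rewrite sgnE derivM derivC mul0r add0r deriv_prod big_distrr /=.
  by apply: eq_bigr => i _; rewrite mulrCA.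
rewrite exchange_big; apply: eq_bigr => i _ /=.
rewrite (partition_big (fun s : 'S_n => s i) predT) //=.
apply: eq_bigr => j _; rewrite expand_cofactor big_distrr /=.
by apply: eq_bigr => s /eqP->.
Qed.

Lemma size_adj_linear (S : comNzRingType) n (P : 'M[{poly S}]_n) i j :
  (forall k l, (size (P k l) <= 2)%N) -> (size (\adj P i j) <= n)%N.
Proof.
move=> sP; case: n P i j sP => [|n] P i j sP; first by case: i.
rewrite mxE /cofactor -signr_odd mulr_sign.
suff: (size (\det (row' j (col' i P))) <= n.+1)%N by case: ifP; rewrite ?size_polyN.
apply: (leq_trans (size_sum _ _ _)); apply/bigmax_leqP => s _.
rewrite -signr_odd mulr_sign.
suff: (size (\prod_k (row' j (col' i P)) k (s k))%R <= n.+1)%N.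
  by case: ifP; rewrite ?size_polyN.
apply: (leq_trans (size_poly_prod_leq _ _)); rewrite card_ord leq_subLR addnS ltnS.
rewrite -[X in (_ <= X + X)%N]card_ord addnn -muln2 -sum_nat_const.
by apply: leq_sum => k _; rewrite !mxE sP.
Qed.

(** Newton's identities in generating form: with C(X) the adjugate of 1 - X M
    and q(X) its determinant, C(X) (1 - X M) = q(X) and
    q'(X) = - tr(C(X) M).  Comparing coefficients by induction, the vanishing
    of the traces and the absence of torsion make every coefficient of q but the constant one vanish, so
    that C(X) is the geometric series of M; since C(X) has degree less than n,
    its coefficient M^n is 0. *)
Lemma nilpotent_mx_of_trace (S : comNzRingType) n (M : 'M[S]_n) :
    torsion_free S -> (forall m, \tr (M ^+ m.+1) = 0) ->
  M ^+ n = 0.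
Proof.
move=> tf trM.
pose P : 'M[{poly S}]_n := 1%:M - 'X *: map_mx polyC M.
pose C m : 'M[S]_n := \matrix_(i, j) (\adj P i j)`_m.
pose q := \det P.
have PE i j : P i j = (i == j)%:R - (M i j)%:P * 'X by rewrite !mxE mulrC.
have adjPE i j :
    \adj P i j - (\adj P *m map_mx polyC M) i j * 'X = q *+ (i == j).
  have := congr1 (fun A : 'M_n => A i j) (mul_adj_mx P).
  rewrite {2}/P mulmxBr mulmx1 -scalemxAr.
  by rewrite ![in X in X -> _]mxE => <-; rewrite [in RHS]mulrC !mxE.
have coefM i j m : ((\adj P *m map_mx polyC M) i j)`_m = (C m *m M) i j.
  by rewrite !mxE coef_sum; apply: eq_bigr => k _; rewrite !mxE coefMC.
(* Evaluation at 0 sends P to the identity matrix. *)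
have C0 : C 0%N = 1%:M.
  have q0 : q`_0 = 1.
    rewrite -horner_coef0 -[q.[0]]/(horner_eval 0 q) -det_map_mx.
    rewrite (_ : map_mx _ _ = 1%:M) ?det1 //; apply/matrixP => i j.
    by rewrite mxE PE /= /horner_eval -polyC_natr !hornerE subr0 mxE.
  apply/matrixP => i j; have /(congr1 (coefp 0)) := adjPE i j.
  by rewrite /= coefB coefMX subr0 coefMn q0 !mxE => ->.
have CS m : C m.+1 = C m *m M + (q`_m.+1)%:M.
  apply/matrixP => i j; have /(congr1 (coefp m.+1)) := adjPE i j.
  rewrite /= coefB coefMX /= coefM coefMn => /eqP; rewrite subr_eq => /eqP E.
  by rewrite !mxE in E *; rewrite E addrC.
have qS m : q`_m.+1 *+ m.+1 = - \tr (C m *m M).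
  rewrite -coef_deriv deriv_det coef_sum mxtrace_mulC /mxtrace -sumrN.
  apply: eq_bigr => i _; rewrite coef_sum mxE -sumrN; apply: eq_bigr => j _.
  rewrite PE derivB derivM derivC derivX mul0r add0r mulr1.
  rewrite (_ : deriv _ = 0); last by case: (_ == _); rewrite derivC.
  by rewrite sub0r -polyCN coefCM !mxE mulNr.
have CE m : C m = M ^+ m.
  elim: m => [|m IHm]; first by rewrite C0.
  have E : C m *m M = M ^+ m.+1 by rewrite IHm exprSr.
  have q0 : q`_m.+1 = 0.
    by apply: (tf _ m); rewrite qS E trM oppr0.
  by rewrite CS E q0 raddf0 addr0.
rewrite -CE; apply/matrixP => i j; rewrite [LHS]mxE [RHS]mxE.
rewrite nth_default // size_adj_linear //.
move=> k l; rewrite PE (leq_trans (size_polyD _ _)) // geq_max size_polyN.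
rewrite -polyC_natr; apply/andP; split.
  by apply: leq_trans (size_polyC_leq1 _) _.
by rewrite (leq_trans (size_polyMleq _ _)) // size_polyX addn2 /= ltnS size_polyC_leq1.
Qed.

(** * Products of anticommuting elements *)

Section Anticommuting.
Context (R : nzRingType) (T : finType).
Implicit Type g : T -> R.

Definition anticommuting g := forall i j, g i * g j = - (g j * g i).

Lemma anticomm_prod g i (s : seq T) : anticommuting g ->
  g i * (\prod_(k <- s) g k) = (-1) ^+ size s * ((\prod_(k <- s) g k) * g i).
Proof.
move=> ga; elim: s => [|j s IHs]; first by rewrite !big_nil mulr1 !mul1r.
rewrite !big_cons /= mulrA ga mulNr -(mulrA _ (g i)) IHs exprS -!mulrA mulN1r.
congr (- _); rewrite !mulrA; congr (_ * _ * _); exact: commr_sign.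
Qed.

(** The two signs produced by carrying g i and g j across the factors between
    them cancel; only the sign of exchanging g i with g j is left. *)
Lemma prod_anticomm_swap g i j (s1 s2 s3 : seq T) : anticommuting g ->
  \prod_(k <- s1 ++ i :: s2 ++ j :: s3) g k
    = - \prod_(k <- s1 ++ j :: s2 ++ i :: s3) g k.
Proof.
move=> ga; rewrite !(big_cat, big_cons) /= -mulrN; congr (_ * _).
rewrite !mulrA -mulNr; congr (_ * _); rewrite !anticomm_prod // -!mulrA -mulrN.
by congr (_ * _); rewrite -mulrN; congr (_ * _); apply: ga.
Qed.

Lemma prod_anticomm_tperm g x y : anticommuting g -> x != y ->
  \prod_k g (tperm x y k) = - \prod_k g k.
Proof.
move=> ga xy.
have gta : anticommuting (g \o tperm x y) by move=> i j; apply: ga.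
have key s1 s2 s3 i j : i != j -> tperm x y = tperm i j ->
    uniq (s1 ++ i :: s2 ++ j :: s3) ->
    \prod_(k <- s1 ++ i :: s2 ++ j :: s3) g (tperm x y k)
      = - \prod_(k <- s1 ++ i :: s2 ++ j :: s3) g k.
  move=> ij -> us; rewrite (prod_anticomm_swap _ _ _ _ _ ga).
  rewrite opprK !(big_cat, big_cons) /= tpermL tpermR.
  have fixE s : i \notin s -> j \notin s ->
      \prod_(k <- s) g (tperm i j k) = \prod_(k <- s) g k.
    move=> si sj; rewrite big_seq [RHS]big_seq; apply: eq_bigr => k ks.
    by rewrite tpermD //; [apply: contraNneq si|apply: contraNneq sj] => ->.
  have usE : uniq [:: i, j & s1 ++ s2 ++ s3].
    rewrite -(perm_uniq (_ : perm_eq (s1 ++ i :: s2 ++ j :: s3) _)) //.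
    apply/seq.permP => a; rewrite !count_cat /= !count_cat /=; lia.
  move: usE; rewrite /= !inE !mem_cat !negb_or => /and3P[/and4P[_ i1 i2 i3]].
  by case/and3P=> j1 j2 j3 _; rewrite !fixE.
have [xI yI] : x \in index_enum T /\ y \in index_enum T.
  by rewrite !mem_index_enum.
have := index_enum_uniq T; case/splitPr: xI yI => s1 s2.
rewrite mem_cat inE eq_sym (negPf xy) /= => /orP[/splitPr[p1 p2]|/splitPr[p1 p2]].
  by rewrite -catA /= => us; apply: (key _ _ _ y x) => //;
    rewrite 1?eq_sym // tpermC.
by move=> us; apply: (key _ _ _ x y).
Qed.

Lemma prod_anticomm_perm g (s : {perm T}) : anticommuting g ->
  \prod_k g (s k) = (-1) ^+ s * \prod_k g k.
Proof.
have [ts -> dts] := prod_tpermP s; elim: ts g dts => [|[x y] ts IHts] g.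
  by move=> _ _; rewrite big_nil odd_perm1 mul1r; apply: eq_bigr => k; rewrite perm1.
case/andP=> /= xy dts ga; rewrite big_cons odd_mul_tperm xy /=.
under eq_bigr do rewrite permM.
rewrite (prod_anticomm_tperm (g := g \o (\prod_(t <- ts) tperm t.1 t.2)%g)) //.
  by rewrite /= IHts // signrN mulNr.
by move=> i j; apply: ga.
Qed.

(** Exchanging the two equal factors changes the sign of the product and leaves
    it unchanged, so twice the product is 0. *)
Lemma prod_anticomm_eq0 g x y :
    torsion_free R -> anticommuting g -> x != y -> g x = g y ->
  \prod_k g k = 0.
Proof.
move=> tf ga xy gxy; apply: (tf _ 1); apply/eqP.
rewrite mulr2n addr_eq0 -(prod_anticomm_tperm ga xy); apply/eqP.
apply: eq_bigr => k _; by case: tpermP => [->|->|].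
Qed.
End Anticommuting.

(** The operators of multiplication by the generators of the exterior algebra,
    built one tensor factor at a time: in M_2(R) = R \otimes M_2, the new
    generator is t \otimes E_01 and the old ones become e_i \otimes 1.  The
    grading operator t, which anticommutes with the generators and becomes
    t \otimes diag(1, -1), carries the induction; being an involution, it
    also shows that the product stays nonzero. *)
Lemma exterior_generators m : exists (R : nzRingType) (e : 'I_m -> R) (t : R),
  [/\ torsion_free R, anticommuting e,
      forall i, t * e i = - (e i * t), t * t = 1 & \prod_i e i != 0].
Proof.
elim: m => [|m [R [e [t [tf ea te tt e0]]]]].
  exists int, (fun=> 0), 1; split.
  - move=> x k /eqP; rewrite -mulr_natr mulf_eq0 => /orP[/eqP//|].
    by rewrite Num.Theory.pnatr_eq0.
  - by case.
  - by case.
  - by [].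
  - by rewrite big_ord0 oner_eq0.
(* D, N and Z are x \otimes 1, x \otimes E_01 and x \otimes diag(1, -1). *)
pose D (x : R) : 'M[R]_(1 + 1) := block_mx x%:M 0 0 x%:M.
pose N (x : R) : 'M[R]_(1 + 1) := block_mx 0 x%:M 0 0.
pose Z (x : R) : 'M[R]_(1 + 1) := block_mx x%:M 0 0 (- x)%:M.
have simpE := (mulmx0, mul0mx, addr0, add0r, oppr0).
have sN x : (- x)%:M = - x%:M :> 'M[R]_1.
  by apply/matrixP => i j; rewrite !mxE mulNrn.
have DD x y : D x * D y = D (x * y).
  by rewrite [LHS]mulmx_block !simpE -!scalar_mxM.
have DN x y : D x * N y = N (x * y).
  by rewrite [LHS]mulmx_block !simpE -!scalar_mxM.
have ND x y : N x * D y = N (x * y).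
  by rewrite [LHS]mulmx_block !simpE -!scalar_mxM.
have NN x y : N x * N y = 0.
  by rewrite [LHS]mulmx_block !simpE -[RHS]block_mx0.
have ZD x y : Z x * D y = Z (x * y).
  by rewrite [LHS]mulmx_block !simpE -!scalar_mxM mulNr.
have DZ x y : D x * Z y = Z (x * y).
  by rewrite [LHS]mulmx_block !simpE -!scalar_mxM mulrN.
have ZN x y : Z x * N y = N (x * y).
  by rewrite [LHS]mulmx_block !simpE -!scalar_mxM.
have NZ x y : N x * Z y = - N (x * y).
  by rewrite [LHS]mulmx_block !simpE -!scalar_mxM mulrN opp_block_mx !simpE sN.
have ZZ x y : Z x * Z y = D (x * y).
  by rewrite [LHS]mulmx_block !simpE -!scalar_mxM mulrNN.
have oppD x : - D x = D (- x) by rewrite opp_block_mx !simpE -!sN.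
have oppN x : - N x = N (- x) by rewrite opp_block_mx !simpE -!sN.
have oppZ x : - Z x = Z (- x) by rewrite opp_block_mx !simpE -!sN.
exists ('M[R]_(1 + 1) : nzRingType).
exists (fun i => if unlift ord0 i is Some j then D (e j) else N t), (Z t).
split.
- move=> x k /matrixP x0; apply/matrixP => i j; rewrite [RHS]mxE; apply: (tf _ k).
  by have := x0 i j; rewrite mulmxnE !mxE.
- move=> i j; case: unliftP => [i' _|_]; case: unliftP => [j' _|_].
  + by rewrite !DD oppD ea.
  + by rewrite DN ND oppN te opprK.
  + by rewrite DN ND oppN te.
  + by rewrite !NN oppr0.
- move=> i; case: unliftP => [j _|_]; last by rewrite ZN NZ opprK.
  by rewrite ZD DZ oppZ te.
- by rewrite ZZ tt /D -scalar_mx_block.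
rewrite big_ord_recl unlift_none.
under eq_bigr do rewrite liftK.
have -> : \prod_(i < m) D (e i) = D (\prod_(i < m) e i).
  apply: (big_ind2 (fun x y => x = D y)) => //; first by rewrite /D -scalar_mx_block.
  by move=> x1 x2 y1 y2 -> ->; rewrite DD.
rewrite ND; apply: contraNneq e0 => /matrixP/(_ (@lshift 1 1 ord0) (@rshift 1 1 ord0)).
rewrite [RHS]mxE (block_mxEur (0 : 'M[R]_1)) mxE eqxx mulr1n => /(congr1 ( *%R t)).
by rewrite mulrA tt mul1r mulr0 => ->.
Qed.

(** * The ring generated by commuting elements *)

Section Bicommutant.
Context (R : nzRingType) (X : R -> Prop).

Definition centralizes (y : R) : Prop := forall x, X x -> x * y = y * x.

Definition bicommutant : {pred R} :=
  fun s => `[< forall y, centralizes y -> s * y = y * s >].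

Lemma bicommutantP s :
  reflect (forall y, centralizes y -> s * y = y * s) (s \in bicommutant).
Proof. exact: asboolP. Qed.

Fact bicommutant_subring : subring_closed bicommutant.
Proof.
split=> [|x y xX yX|x y xX yX].
- by apply/bicommutantP => y _; rewrite mul1r mulr1.
- apply/bicommutantP => z zX; rewrite mulrBl mulrBr.
  by rewrite (bicommutantP _ xX) // (bicommutantP _ yX).
- apply/bicommutantP => z zX.
  by rewrite -mulrA (bicommutantP _ yX) // mulrA (bicommutantP _ xX) // mulrA.
Qed.

HB.instance Definition _ := GRing.isSubringClosed.Build R bicommutant
  bicommutant_subring.

Record bicommutant_ring := Bicommutant {
  bicommutant_val : R;
  _ : bicommutant_val \in bicommutant
}.

HB.instance Definition _ := [isSub for bicommutant_val].
HB.instance Definition _ := [Choice of bicommutant_ring by <:].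
HB.instance Definition _ := [SubChoice_isSubNzRing of bicommutant_ring by <:].

Lemma mem_bicommutant x : X x -> x \in bicommutant.
Proof. by move=> Xx; apply/bicommutantP => y; apply. Qed.

(** If X is commutative then X centralizes itself, so a bicommutant element
    commutes with all of X, hence centralizes X, and therefore commutes with
    every other bicommutant element.  This gives a commutative subring
    around X, over which determinants make sense. *)
Lemma bicommutant_comm_ring : (forall x y, X x -> X y -> x * y = y * x) ->
  exists (S : comNzRingType) (iota : {rmorphism S -> R}),
    [/\ injective iota, forall s, iota s \in bicommutant &
        forall a, a \in bicommutant -> exists s, iota s = a].
Proof.
move=> XC.
have mulC : @commutative bicommutant_ring _ *%R.
  move=> a b; apply: val_inj; rewrite !rmorphM /=.
  apply: (bicommutantP _ (valP a)) => x Xx.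
  by symmetry; apply: (bicommutantP _ (valP b)) => y Xy; apply: XC.
pose S : comNzRingType := HB.pack bicommutant_ring
  (GRing.PzRing_hasCommutativeMul.Build bicommutant_ring mulC).
exists S, (val : {rmorphism bicommutant_ring -> R}).
by split=> [|s|a aX]; [apply: val_inj|apply: valP|exists (Bicommutant aX)].
Qed.
End Bicommutant.

(** * The theorem of Amitsur and Levitzki *)

Definition standard_sum (R : pzRingType) m (a : 'I_m -> R) : R :=
  \sum_(s : 'S_m) (-1) ^+ s * \prod_k a (s k).

Lemma standard_sum_map (R S : pzRingType) (f : {rmorphism R -> S}) m
  (a : 'I_m -> R) : standard_sum (f \o a) = f (standard_sum a).
Proof.
rewrite rmorph_sum; apply: eq_bigr => s _.
by rewrite rmorphM rmorph_sign rmorph_prod.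
Qed.

Lemma mulmx_scalarE (R : pzRingType) n (A : 'M[R]_n) x p q :
  (A *m x%:M) p q = A p q * x.
Proof.
rewrite mxE (bigD1 q) //= big1 ?addr0 => [|r rq]; first by rewrite mxE eqxx.
by rewrite mxE (negPf rq) mulr0.
Qed.

(** In the expansion of the power, a repeated generator annihilates its term;
    the other terms are indexed by permutations, and sorting the generators
    produces the signature. *)
Lemma standard_sum_expand (R : nzRingType) m (U : pzRingType)
    (iota : {rmorphism R -> U}) (e : 'I_m -> R) (b : 'I_m -> U) :
    torsion_free R -> anticommuting e ->
    (forall i x, b i * iota x = iota x * b i) ->
  (\sum_i b i * iota (e i)) ^+ m = standard_sum b * iota (\prod_i e i).
Proof.
move=> tf ea bC.
set A := \sum_i _; have -> : A ^+ m = \prod_(k < m) A by rewrite prodr_const card_ord.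
rewrite bigA_distr_bigA /=.
rewrite (bigID (fun f : {ffun 'I_m -> 'I_m} => injectiveb f)) /= addrC big1 ?add0r.
  rewrite (reindex (@pval _)) /=; last first.
    pose in_Sn := insubd (1%g : 'S_m).
    by exists in_Sn => /= f Uf; first apply: val_inj; apply: insubdK.
  rewrite big_distrl; apply: eq_big => /= [s | s _]; rewrite ?(valP s) //.
  rewrite prodrM_comm; last by move=> i j _ _; apply: bC.
  under eq_bigr do rewrite pvalE; under [X in _ * X]eq_bigr do rewrite pvalE.
  rewrite -rmorph_prod (prod_anticomm_perm s ea) rmorphM rmorph_sign.
  by rewrite mulrA (commr_sign _ s).
move=> f /injectivePn[i1 [i2 Di12 Ef12]].
rewrite prodrM_comm; last by move=> i j _ _; apply: bC.
have fa : anticommuting (e \o f) by move=> i j; apply: ea.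
rewrite -rmorph_prod (prod_anticomm_eq0 tf fa Di12) ?rmorph0 ?mulr0 //=.
by rewrite Ef12.
Qed.

(** Rosset's argument; integer coefficients keep the absence of torsion and
    commute with the generators. *)
Lemma amitsur_levitzki_int n (a : 'I_n.*2 -> 'M[int]_n) : standard_sum a = 0.
Proof.
have [R [e [_ [tf ea _ _ e0]]]] := exterior_generators n.*2.
pose X x := exists i j, x = e i * e j.
have eX i : centralizes X (e i).
  move=> _ [j [k ->]].
  by rewrite -mulrA (ea k i) mulrN [in LHS]mulrA (ea j i) mulNr opprK mulrA.
have XC x y : X x -> X y -> x * y = y * x.
  move=> Xx [i [j ->]]; rewrite mulrA (eX i) // -mulrA (eX j) //.
  by rewrite mulrA.
have [S [iota [iota_inj iotaX memS]]] := bicommutant_comm_ring XC.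
pose b i : 'M[R]_n := map_mx intr (a i).
pose A : 'M[R]_n := \sum_i b i * (e i)%:M.
have AE p q : A p q = \sum_i e i *~ a i p q.
  rewrite summxE; apply: eq_bigr => i _.
  by rewrite mulmx_scalarE mxE mulrzl.
have A_anti p q r s : A p q * A r s = - (A r s * A p q).
  rewrite !AE !big_distrl /= -sumrN.
  under eq_bigr do rewrite big_distrr; under [RHS]eq_bigr do rewrite big_distrr -sumrN.
  rewrite exchange_big; apply: eq_bigr => i _; apply: eq_bigr => j _ /=.
  by rewrite !(mulrzAl, mulrzAr) ea !mulNrz -!mulrzA mulrC.
(* Even elements commute with odd ones, so powers of A^2 commute with the
   entries of A. *)
have sA (s : S) p q : iota s * A p q = A p q * iota s.
  rewrite AE big_distrl big_distrr; apply: eq_bigr => i _ /=.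
  by rewrite mulrzAl mulrzAr (bicommutantP _ _ (iotaX s)).
have [M ME] : exists M : 'M[S]_n, map_mx iota M = A * A.
  have /choice[F FE] : forall pq : 'I_n * 'I_n, exists s, iota s = (A * A) pq.1 pq.2.
    move=> [p q]; apply: memS; rewrite mxE rpred_sum // => r _.
    rewrite !AE big_distrl rpred_sum // => i _; rewrite big_distrr rpred_sum // => j _.
    rewrite /= mulrzAl mulrzAr -mulrzA; apply: rpredMz.
    by apply: mem_bicommutant; exists i, j.
  by exists (\matrix_(p, q) F (p, q)); apply/matrixP => p q; rewrite !mxE FE mxE.
(* With T = A^2m: tr(A (A T)) = - tr((A T) A) by anticommutation of the
   entries, and A commutes with T, so the trace equals its opposite. *)
have trM m : \tr (M ^+ m.+1) = 0.
  apply: iota_inj; rewrite -trace_map_mx rmorph0; apply: (tf _ 1).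
  pose T := map_mx iota (M ^+ m).
  have TA : T * A = A * T by rewrite /T rmorphXn /= ME -expr2 -exprM -exprSr -exprS.
  apply/eqP; rewrite mulr2n addr_eq0 rmorphXn /= exprS ME -[X in \tr X]mulrA.
  rewrite -[(A * A) ^+ m](_ : T = _); last by rewrite /T rmorphXn /= ME.
  rewrite -[in X in _ == - X]TA [in X in _ == - X]mulrA.
  rewrite /mxtrace -sumrN.
  under eq_bigr do rewrite mxE; under [X in _ == X]eq_bigr do rewrite mxE -sumrN.
  rewrite exchange_big; apply/eqP; apply: eq_bigr => q _; apply: eq_bigr => p _ /=.
  rewrite mxE big_distrr big_distrl -sumrN; apply: eq_bigr => r _ /=.
  by rewrite mulrA A_anti mulNr -!mulrA [T r p]mxE sA.
have Mn : M ^+ n = 0.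
  apply: nilpotent_mx_of_trace trM => x k xk; apply: iota_inj; rewrite rmorph0.
  by apply: (tf _ k); rewrite -rmorphMn xk rmorph0.
have : A ^+ n.*2 = 0.
  by rewrite -muln2 mulnC exprM expr2 -ME -rmorphXn Mn rmorph0.
rewrite (standard_sum_expand (iota := @scalar_mx R n) tf ea); last first.
  move=> i x; apply/matrixP => p q; rewrite mulmx_scalarE [RHS]mxE (bigD1 p) //= big1.
    by rewrite !mxE eqxx addr0 mulrzl mulrzr.
  by move=> r rp; rewrite mxE eq_sym (negPf rp) mul0r.
rewrite (standard_sum_map (map_mx intr : {rmorphism 'M[int]_n -> 'M[R]_n})).
move=> /matrixP E0; apply/matrixP => p q; have := E0 p q.
rewrite mulmx_scalarE !mxE mulrzl; set E := \prod_i _ in e0 *.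
case: (standard_sum a p q) => [[|k]|k] // /eqP; rewrite ?oppr_eq0 => /eqP Ek.
  by rewrite (tf _ k Ek) eqxx in e0.
by rewrite (tf _ k Ek) eqxx in e0.
Qed.

(** The standard polynomial is multilinear, so v may be taken among the matrix
    units, which are images of integer matrices. *)
Lemma amitsur_levitzki (B : comPzRingType) n (v : 'I_n.*2 -> 'M[B]_n) :
  standard_sum v = 0.
Proof.
pose D (pq : 'I_n * 'I_n) : 'M[int]_n := delta_mx pq.1 pq.2.
pose DB pq : 'M[B]_n := map_mx intr (D pq).
pose c k (pq : 'I_n * 'I_n) := v k pq.1 pq.2.
have vE k : v k = \sum_pq c k pq *: DB pq.
  rewrite {1}(matrix_sum_delta (v k)) pair_big /=; apply: eq_bigr => pq _.
  by rewrite /DB map_delta_mx.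
transitivity (\sum_(f : {ffun 'I_n.*2 -> 'I_n * 'I_n})
    (\prod_k c k (f k)) *: standard_sum (DB \o f)); last first.
  rewrite big1 // => f _.
  rewrite (standard_sum_map (map_mx intr) (D \o f)).
  by rewrite amitsur_levitzki_int raddf0 scaler0.
under [RHS]eq_bigr do rewrite scaler_sumr.
rewrite [RHS]exchange_big; apply: eq_bigr => s _ /=.
under eq_bigr do rewrite vE.
rewrite bigA_distr_bigA /= big_distrr /=.
pose h (u : {perm 'I_n.*2}) (f : {ffun 'I_n.*2 -> 'I_n * 'I_n}) := [ffun k => f (u k)].
rewrite (reindex (h s)) /=; last first.
  by exists (h (s^-1)%g) => f _; apply/ffunP => k; rewrite !ffunE (permK, permKV).
apply: eq_bigr => f _.
under eq_bigr do rewrite ffunE.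
have -> : \prod_k (c (s k) (f (s k)) *: DB (f (s k)))
    = (\prod_k c (s k) (f (s k))) *: \prod_k DB (f (s k)).
  apply: (big_rec3 (fun (z : 'M[B]_n) x y => y = x *: z)) => [|k z x y _ ->].
    by rewrite scale1r.
  by rewrite -[LHS]scalemxAl -[in LHS]scalemxAr scalerA.
by rewrite -[LHS]scalemxAr [in RHS](reindex_perm s).
Qed.

(** * The square of the standard polynomial *)

Section StandardPolynomialSquare.
Variable r : nat.
Implicit Types s t : 'S_r.

Definition perm_word s : seq nat := [seq val (s i) | i <- index_enum 'I_r].

Lemma size_perm_word s : size (perm_word s) = r.
Proof. by rewrite size_map -sum1_size sum_nat_const card_ord muln1. Qed.

Lemma perm_word_inj : injective perm_word.
Proof.
move=> s t /eq_in_map st; apply/permP => i; apply: val_inj.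
by apply: st; rewrite mem_index_enum.
Qed.

Definition perm_word2 (p : 'S_r * 'S_r) : {fmonom nat} :=
  FMonom (perm_word p.1 ++ perm_word p.2).

(** Both halves have length r, so the word can be cut back into its halves;
    hence no two terms of the expanded square have the same word. *)
Lemma perm_word2_inj : injective perm_word2.
Proof.
move=> [s t] [s' t'] /(congr1 (@fmonom_val _)) /= /eqP.
rewrite eqseq_cat ?size_perm_word // => /andP[].
by move=> /eqP/perm_word_inj-> /eqP/perm_word_inj->.
Qed.

Lemma fdeg_perm_word2 p : fdeg (perm_word2 p) = r.*2.
Proof. by rewrite /fdeg /= size_cat !size_perm_word addnn. Qed.

Lemma prod_ncvar (T : Type) (g : T -> nat) (l : seq T) :
  \prod_(i <- l) ncvar (g i) = << FMonom [seq g i | i <- l] >>.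
Proof.
elim: l => [|i l IHl]; first by rewrite big_nil /= -fmoneE.
by rewrite big_cons IHl malgM_def fgmulUU mulr1 /= fmuE [mmul _ _]fmmulE.
Qed.

Lemma standard_poly_sqr : standard_poly r ^+ 2 =
  \sum_(p : 'S_r * 'S_r) << ((-1) ^+ p.1 * (-1) ^+ p.2 : int) *g perm_word2 p >>.
Proof.
have spE : standard_poly r =
    \sum_(s : 'S_r) << ((-1) ^+ s : int) *g FMonom (perm_word s) >>.
  apply: eq_bigr => s _; rewrite (prod_ncvar (fun i => val (s i))).
  by case: (odd_perm s); rewrite ?mul1r // mulN1r -monalgUN.
rewrite expr2 spE big_distrlr pair_big /=; apply: eq_bigr => p _.
by rewrite malgM_def fgmulUU [mmul _ _]fmmulE.
Qed.

Lemma mcoeff_standard_poly_sqr u : (standard_poly r ^+ 2)@_u =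
  \sum_(p : 'S_r * 'S_r) ((-1) ^+ p.1 * (-1) ^+ p.2) *+ (perm_word2 p == u).
Proof.
by rewrite standard_poly_sqr raddf_sum; apply: eq_bigr => p _; rewrite /= mcoeffU.
Qed.

Lemma fdeg_standard_poly_sqr u :
  (standard_poly r ^+ 2)@_u != 0 -> fdeg u = r.*2.
Proof.
apply: contra_neq_eq => ur; rewrite mcoeff_standard_poly_sqr big1 // => p _.
by case: eqVneq => // pu; rewrite -pu fdeg_perm_word2 eqxx in ur.
Qed.

Lemma monic_standard_poly_sqr : monic_ncpoly (standard_poly r ^+ 2).
Proof.
have c1 : (standard_poly r ^+ 2)@_(perm_word2 (1%g, 1%g)) = 1.
  rewrite mcoeff_standard_poly_sqr (bigD1 (1%g, 1%g)) //= big1 ?addr0 => [|p p1].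
    by rewrite eqxx odd_perm1 mulr1.
  by rewrite (inj_eq perm_word2_inj) (negPf p1).
exists (perm_word2 (1%g, 1%g)); split=> // [|u].
  by rewrite -mcoeff_neq0 c1.
by rewrite -mcoeff_neq0 fdeg_perm_word2 => /fdeg_standard_poly_sqr->.
Qed.

Section Evaluation.
Context (R : rngType) (v : nat -> R).

(** Evaluation sums over the support, which is not additive; the sum may be
    taken over any larger finite set of words. *)
Lemma eval_ncpolyD : {morph eval_ncpoly v : f g / f + g}.
Proof.
have evalE (f : ncpoly) (d : {fset {fmonom nat}}) : (msupp f `<=` d)%fset ->
    eval_ncpoly v f = \sum_(w <- d) eval_word v w *~ f@_w.
  move=> fd; apply: big_fset_incl fd _ => w _ wf.
  by rewrite mcoeff_outdom.
move=> f g; have fgd := msuppD_le f g.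
rewrite (evalE _ _ fgd) (evalE f _ (fsubsetUl _ (msupp g))).
rewrite (evalE g _ (fsubsetUr (msupp f) _)).
by rewrite -big_split; apply: eq_bigr => w _ /=; rewrite mcoeffD mulrzDr.
Qed.

Lemma eval_ncpolyU c w : eval_ncpoly v << c *g w >> = eval_word v w *~ c.
Proof.
rewrite /eval_ncpoly msuppU; case: eqVneq => [->|_].
  by rewrite big_seq_fset0.
by rewrite big_seq_fset1 mcoeffUU.
Qed.

Lemma eval_standard_poly_sqr : eval_ncpoly v (standard_poly r ^+ 2) =
  \sum_(p : 'S_r * 'S_r)
     eval_word v (perm_word2 p) *~ ((-1) ^+ p.1 * (-1) ^+ p.2).
Proof.
rewrite standard_poly_sqr (big_morph _ eval_ncpolyD (id1 := 0)).
  by apply: eq_bigr => p _; rewrite eval_ncpolyU.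
by rewrite /eval_ncpoly msupp0 big_seq_fset0.
Qed.

Lemma eval_word_cat w1 w2 : w1 != [::] -> w2 != [::] ->
  eval_word v (w1 ++ w2) = eval_word v w1 ** eval_word v w2.
Proof.
case: w1 w2 => // i w1 [//|j w2] _ _ /=; rewrite foldl_cat /=.
elim: w2 (v j) => //= k w2 IH a; by rewrite -rngmulA IH.
Qed.
End Evaluation.
End StandardPolynomialSquare.

Section StandardIdentity.
Context (B : comPzRingType) (n : nat) (psi : 'M[B]_n).
Local Notation J := (gmatrix psi : rngType).

Lemma gmatrixE (a b : J) : a ** b = (a : 'M[B]_n) *m psi *m (b : 'M[B]_n).
Proof. by []. Qed.

Lemma eval_word_mul_psi (v : nat -> J) (w : seq nat) : w != [::] ->
  (eval_word v w : 'M[B]_n) *m psi = \prod_(i <- w) ((v i : 'M[B]_n) *m psi : 'M_n).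
Proof.
case: w => // i w _; rewrite big_cons /=.
elim: w (v i) => [|j w IHw] a /=; first by rewrite big_nil mulr1.
by rewrite IHw gmatrixE big_cons mulrA -[(_ : 'M_n) *m _ *m _ *m _]mulmxA.
Qed.

(** Only the first of the two factors needs the theorem of Amitsur and Levitzki:
    the psi that multiplies it in J brings it into M_n(B). *)
Lemma satisfies_standard_poly_sqr : (0 < n)%N ->
  satisfies J (standard_poly n.*2 ^+ 2).
Proof.
move=> n_gt0; split.
  apply/eqP; apply: contraTT n_gt0 => /fdeg_standard_poly_sqr.
  by rewrite fmoneE /fdeg /= -leqNgt; case: n.
move=> v; rewrite eval_standard_poly_sqr.
have wn0 (s : 'S_n.*2) : perm_word s != [::].
  by rewrite -size_eq0 size_perm_word double_eq0 -lt0n.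
pose E (s : 'S_n.*2) : 'M[B]_n := eval_word v (perm_word s).
have AL : \sum_(s : 'S_n.*2) (E s *m psi) *~ ((-1) ^+ s) = 0.
  pose vpsi (k : 'I_n.*2) : 'M[B]_n := (v k : 'M_n) *m psi.
  rewrite -[RHS](amitsur_levitzki vpsi); apply: eq_bigr => s _.
  rewrite eval_word_mul_psi // big_map.
  by case: (odd_perm s); rewrite ?mul1r // mulN1r mulrNz mulr1z.
rewrite -(pair_big predT predT (fun s t : 'S_n.*2 =>
  eval_word v (perm_word2 (s, t)) *~ ((-1) ^+ s * (-1) ^+ t))) exchange_big.
rewrite big1 // => t _ /=.
transitivity ((\sum_(s : 'S_n.*2) (E s *m psi) *~ ((-1) ^+ s)) *m E t *~ (-1) ^+ t).
  rewrite mulmx_suml mulrz_suml; apply: eq_bigr => s _; rewrite eval_word_cat //.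
  rewrite mulrzA; congr (_ *~ _).
  by case: (odd_perm s); rewrite // !mulrNz !mulr1z mulNmx.
by rewrite AL mul0mx mul0rz.
Qed.
End StandardIdentity.

(** * McCoy's theorem *)

Lemma mxsub_det_mul (B : comPzRingType) n (A : 'M[B]_n) (f g : 'I_n -> 'I_n) :
  exists c, \det (mxsub f g A) = c * \det A.
Proof.
exists (\det (rowsub f 1%:M : 'M[B]_n) * \det (colsub g 1%:M : 'M[B]_n)).
rewrite mulrAC -!det_mulmx; congr (\det _).
by rewrite mul_rowsub_mx mul1mx -mxsub_mul mulmx1.
Qed.

(** There is r < n such that b kills all minors of size r + 1, but not a certain
    minor of size r, on rows f and columns g.  Add a column j0 outside g: the cofactors
    along one further row, multiplied by b, are the coefficients of the
    required vector u.  Its entry at j0 is b times the chosen minor, and the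
    entries of A u are b times minors of size r + 1.  Rows and columns are
    arbitrary functions, so minors with repetitions are included; they
    vanish. *)
Lemma mccoy_kernel (B : comPzRingType) n (A : 'M[B]_n) (b : B) :
  b != 0 -> b * \det A = 0 -> exists2 u : 'cV[B]_n, u != 0 & A *m u = 0.
Proof.
move=> b0 bA.
pose P r := exists f g : 'I_r -> 'I_n, b * \det (mxsub f g A) != 0.
have P0 : P 0%N.
  have no_ord : 'I_0 -> 'I_n by case.
  by exists no_ord, no_ord; rewrite det_mx00 mulr1.
have Pn : ~ P n.
  move=> [f [g]]; have [c ->] := mxsub_det_mul A f g.
  by rewrite mulrCA bA mulr0 eqxx.
have [r [rn [f [g fg]] Pr1]] : exists r, [/\ (r < n)%N, P r & ~ P r.+1].
  apply: contrapT => noP; apply: Pn.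
  have: (n <= n)%N by [].
  elim: {1 3}n => // r IHr rn; apply: contrapT => Pr1; apply: noP.
  by exists r; split=> //; apply: IHr; apply: ltnW.
have [j0 j0g] : exists j0, forall k, g k != j0.
  apply: contrapT => /forallNP gs; suff: (n <= r)%N by rewrite leqNgt rn.
  have /choice[h hE] : forall j, exists k, g k = j.
    move=> j; apply: contrapT => /forallNP gj; apply: (gs j) => k.
    by apply/eqP; apply: gj.
  rewrite -[n]card_ord -[r in (_ <= r)%N]card_ord; apply: (leq_card h).
  exact: (can_inj hE).
pose g' (k : 'I_r.+1) := if unlift ord0 k is Some k' then g k' else j0.
pose f' i (k : 'I_r.+1) := if unlift ord0 k is Some k' then f k' else i.
pose cof k := b * cofactor (mxsub (f' j0) g' A) ord0 k.
(* The cofactors along row 0 do not see that row. *)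
have cofE i k : b * cofactor (mxsub (f' i) g' A) ord0 k = cof k.
  rewrite /cof /cofactor; congr (_ * (_ * \det _)); apply/matrixP => x y.
  by rewrite !mxE /f' !liftK.
exists (\sum_k cof k *: delta_mx (g' k) ord0).
  apply: contraNneq fg => /matrixP/(_ j0 ord0).
  rewrite summxE (bigD1 ord0) //= big1 => [|k].
    rewrite !mxE {1}/g' unlift_none !eqxx mulr1 addr0 /cof /cofactor => <-.
    rewrite expr0 mul1r; apply/eqP; congr (_ * \det _); apply/matrixP => x y.
    by rewrite !mxE /f' /g' !liftK.
  case: (unliftP ord0 k) => [k' ->|->]; rewrite ?eqxx // => _.
  by rewrite !mxE /g' liftK eq_sym (negPf (j0g k')) mulr0.
apply/matrixP => i j; rewrite ord1 mulmx_sumr summxE [RHS]mxE.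
transitivity (b * \det (mxsub (f' i) g' A)).
  rewrite (expand_det_row _ ord0) big_distrr; apply: eq_bigr => k _ /=.
  rewrite mulrCA cofE -scalemxAr mxE mulrC; congr (_ * _).
  rewrite -colE !mxE; congr (A _ _).
  by rewrite /f' unlift_none.
by apply/eqP; apply: contra_notT Pr1 => nz; exists (f' i), g'.
Qed.

(** * Semiprimeness *)

Lemma delta_mx_corner (B : comPzRingType) n (a : 'M[B]_n) (i p q j : 'I_n) :
  delta_mx i p *m a *m delta_mx q j = a p q *: delta_mx i j.
Proof.
apply/matrixP => x y; rewrite !mxE (bigD1 q) //= big1 ?addr0.
  rewrite !mxE (bigD1 p) //= big1 ?addr0.
    rewrite !mxE !eqxx andbT.
    by case: (x == i); case: (y == j); rewrite /= ?(mulr0, mul0r, mulr1, mul1r).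
  by move=> k kp; rewrite !mxE (negPf kp) andbF mul0r.
by move=> k kq; rewrite !mxE (negPf kq) mulr0.
Qed.

Section AdditiveSpan.
Context (V : zmodType).
Implicit Types G A : set V.

Lemma addsubgroup_addspan G : addsubgroup (addspan G).
Proof.
split=> [A [[A0 _] _] //|x y Gx Gy A [[A0 AB] GA]].
by apply: (AB); [apply: Gx; split|apply: Gy; split].
Qed.

Lemma addspan_sub G A : addsubgroup A -> G `<=` A -> addspan G `<=` A.
Proof. exact: smallest_sub. Qed.

Lemma mem_addspan G x : G x -> addspan G x.
Proof. exact: sub_gen_smallest. Qed.

Lemma addsubgroupD A x y : addsubgroup A -> A x -> A y -> A (x + y).
Proof.
case=> A0 AB Ax Ay; rewrite -[y]opprK; apply: (AB) => //.
by rewrite -sub0r; apply: (AB).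
Qed.

Lemma addsubgroup_sum A (T : Type) (r : seq T) (P : pred T) (F : T -> V) :
  addsubgroup A -> (forall i, P i -> A (F i)) -> A (\sum_(i <- r | P i) F i).
Proof.
move=> Asub AF; elim/big_ind: _ => //; first by case: Asub.
by move=> x y; apply: addsubgroupD.
Qed.
End AdditiveSpan.

Section NilpotentSets.
Context (R : rngType).
Implicit Types A : set R.

Lemma mem_rng_setmul A C a c : A a -> C c -> rng_setmul A C (a ** c).
Proof. by move=> Aa Cc; apply: mem_addspan; exists a => //; exists c. Qed.

Lemma rng_setmul_sub A C D : addsubgroup D ->
  (forall a c, A a -> C c -> D (a ** c)) -> rng_setmul A C `<=` D.
Proof. by move=> Dsub ACD; apply: addspan_sub => // _ [a Aa [c Cc <-]]; apply: ACD. Qed.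

Lemma addsubgroup_iter A m : addsubgroup A -> addsubgroup (iter m (rng_setmul A) A).
Proof. by case: m => //= m _; apply: addsubgroup_addspan. Qed.

Lemma nilpotent_setP A m : addsubgroup A ->
  iter m (rng_setmul A) A `<=` [set 0] -> nilpotent_set A.
Proof.
move=> Asub Am; exists m; apply/seteqP; split=> // _ ->.
by case: (addsubgroup_iter m Asub).
Qed.
End NilpotentSets.

Lemma nonzero_divisorP (B : comPzRingType) (d x : B) :
  ~ zero_divisor d -> d * x = 0 -> x = 0.
Proof. by move=> nd dx; apply: contra_notP nd => /eqP x0; exists x. Qed.

Section Semiprimeness.
Context (B : comPzRingType) (n : nat) (psi : 'M[B]_n).
Local Notation J := (gmatrix psi : rngType).
Local Notation d := (\det psi).

Lemma adj_central : central (\adj psi : J).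
Proof.
by move=> a; rewrite !gmatrixE mul_adj_mx -mulmxA mul_mx_adj scalar_mxC.
Qed.

Lemma semiprime_reduced : (0 < n)%N -> semiprime J -> reduced B.
Proof.
move=> n_gt0 sp b m bm.
have bm1 : b ^+ m.+1 = 0 by rewrite exprS bm mulr0.
pose C k : set J := [set a | exists x : 'M[B]_n, a = b ^+ k *: x].
have Csub k : addsubgroup (C k).
  split; first by exists 0; rewrite scaler0.
  by move=> _ _ [x ->] [y ->]; exists (x - y); rewrite scalerBr.
have CE : C 1%N = [set 0].
  apply: sp; first split=> //.
    move=> a _ [x ->]; split; rewrite gmatrixE.
      by exists (a *m psi *m x); rewrite -scalemxAr.
    by exists (x *m psi *m a); rewrite -!scalemxAl.
  apply: (@nilpotent_setP _ _ m) => // a.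
  suff: forall k, iter k (rng_setmul (C 1%N)) (C 1%N) `<=` C k.+1.
    by move=> /(_ m a) H /H[x ->]; rewrite bm1 scale0r.
  elim=> //= k IHk; apply: rng_setmul_sub => // _ _ [x ->] /IHk[y ->].
  exists (x *m psi *m y).
  by rewrite gmatrixE -!scalemxAl -scalemxAr scalerA -exprD add1n.
have : C 1%N (b%:M : 'M_n) by exists 1%:M; rewrite expr1 scalemx1.
rewrite CE => /matrixP/(_ (Ordinal n_gt0) (Ordinal n_gt0)).
by rewrite !mxE eqxx.
Qed.

(** N below is an ideal of J with N * N contained in L and N * L = 0, so it is
    nilpotent; a column killed by psi gives an element of N. *)
Lemma semiprime_regular : (0 < n)%N -> semiprime J -> ~ zero_divisor d.
Proof.
move=> n_gt0 sp [b b0 db].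
have [u u0 psiu] : exists2 u : 'cV[B]_n, u != 0 & psi *m u = 0.
  by apply: (mccoy_kernel b0); rewrite mulrC.
pose N : set J := [set a : 'M[B]_n | psi *m a *m psi = 0].
pose L : set J := [set a : 'M[B]_n | psi *m a = 0].
have Nsub : addsubgroup N.
  split; first by rewrite /N /= mulmx0 mul0mx.
  by move=> x y Nx Ny; rewrite /N /= mulmxBr mulmxBl Nx Ny subr0.
have Lsub : addsubgroup L.
  split; first by rewrite /L /= mulmx0.
  by move=> x y Lx Ly; rewrite /L /= mulmxBr Lx Ly subr0.
have NE : N = [set 0].
  apply: sp; first split=> //.
    move=> a x Nx; split; rewrite /N /= gmatrixE.
      by rewrite -!mulmxA; rewrite (mulmxA psi x) Nx !mulmx0.
    by rewrite !mulmxA Nx !mul0mx.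
  apply: (@nilpotent_setP _ _ 2) => //=.
  apply: rng_setmul_sub; first by split=> // x y -> ->; rewrite subr0.
  move=> a c _ Nc; suff Lc : L c by rewrite /= gmatrixE -mulmxA Lc mulmx0.
  move: Nc; apply: rng_setmul_sub => // x y Nx _.
  by rewrite /L /= gmatrixE !mulmxA Nx mul0mx.
have : N (\matrix_(i, j) u i ord0).
  rewrite /N /= (_ : psi *m _ = 0) ?mul0mx //.
  apply/matrixP => i j; have /matrixP/(_ i ord0) := psiu.
  by rewrite !mxE => psiu0; rewrite -[RHS]psiu0; apply: eq_bigr => k _; rewrite !mxE.
rewrite NE => /matrixP u0E; case/eqP: u0; apply/matrixP => i j.
by have := u0E i (Ordinal n_gt0); rewrite !mxE (ord1 j).
Qed.

(** Flanking a by \adj psi and matrix units isolates its entries: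
    (E_ip \adj psi) * a * (\adj psi E_qj) = d^2 a_pq E_ij.  Thus A contains
    y = c \adj psi with c = d^2 a_pq, and nilpotency of y in J says that a
    power of c d is 0. *)
Lemma reduced_regular_semiprime : (0 < n)%N ->
  reduced B -> ~ zero_divisor d -> semiprime J.
Proof.
move=> n_gt0 redB regd A [Asub Aideal] [m Am].
apply/seteqP; split=> [a Aa|_ ->]; last by case: Asub.
apply/matrixP => p q; rewrite [RHS]mxE.
pose c := d ^+ 2 * (a : 'M[B]_n) p q.
have AE b i j : A ((b * c) *: delta_mx i j : 'M_n).
  have := Aideal (b *: delta_mx i p *m \adj psi : 'M_n) a Aa => -[/Aideal + _].
  move=> /(_ (\adj psi *m delta_mx q j : 'M_n))[_]; rewrite !gmatrixE.
  congr A; rewrite -!mulmxA (mulmxA psi (\adj psi)) mul_mx_adj.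
  rewrite (mulmxA (\adj psi) psi) mul_adj_mx !mul_scalar_mx.
  rewrite -!scalemxAl -!scalemxAr !scalerA.
  rewrite mulmxA delta_mx_corner.
  by rewrite scalerA /c expr2 !mulrA.
have Ay : A (c *: \adj psi : 'M_n).
  rewrite (matrix_sum_delta (\adj psi)) scaler_sumr.
  apply: addsubgroup_sum => // i _; rewrite scaler_sumr.
  by apply: addsubgroup_sum => // j _; rewrite scalerA mulrC.
have Apow k : iter k (rng_setmul A) A ((c ^+ k.+1 * d ^+ k) *: \adj psi : 'M_n).
  elim: k => [|k IHk]; first by rewrite mulr1.
  have := @mem_rng_setmul J A _ _ _ Ay IHk; rewrite gmatrixE.
  rewrite -!scalemxAl mul_adj_mx mul_scalar_mx !scalerA.
  by rewrite /= mulrACA -!exprS.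
have := Apow m; rewrite Am => /(congr1 (mulmx psi)); rewrite mulmx0 -scalemxAr mul_mx_adj.
move=> /matrixP/(_ (Ordinal n_gt0) (Ordinal n_gt0)); rewrite !mxE eqxx mulr1n.
rewrite -mulrA -exprSr -exprMn => /redB; rewrite /c => cd0.
apply: (nonzero_divisorP regd); apply: (nonzero_divisorP regd).
by apply: (nonzero_divisorP regd); rewrite mulrA -expr2 mulrCA mulrC.
Qed.
End Semiprimeness.

(** * Endomorphisms of the regular module *)

Section Endomorphisms.
Context (B : comPzRingType) (n : nat) (psi : 'M[B]_n).
Local Notation J := (gmatrix psi : rngType).

Lemma regular_actE (a x : rng_regular J) :
  rngact (a : J) x = (a : 'M[B]_n) *m psi *m (x : 'M[B]_n).
Proof. by []. Qed.

(** The isomorphism is f |-> f(1).  It preserves products because the left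
    factor is applied first: (f g)(1) = g(f(1)) = f(1) g(1). *)
Lemma End_regular_iso :
    (forall (f : rngEnd (rng_regular J)) (x : 'M[B]_n),
       f x = x *m (f (1%:M : 'M[B]_n) : 'M[B]_n)) ->
  ring_isomorphic (rngEnd (rng_regular J)) 'M[B]_n.
Proof.
move=> fE.
pose ev (f : rngEnd (rng_regular J)) : 'M[B]_n := f (1%:M : 'M[B]_n).
have evB : zmod_morphism ev by [].
have evM : monoid_morphism ev by split=> // f g; exact: (fE g (ev f)).
pose F : {rmorphism rngEnd (rng_regular J) -> 'M[B]_n} := HB.pack ev
  (GRing.isZmodMorphism.Build _ _ ev evB) (GRing.isMonoidMorphism.Build _ _ ev evM).
have rmul_lin (c : 'M[B]_n) :
    @rng_linear J (rng_regular J) (fun x => (x : 'M[B]_n) *m c).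
  by split=> [x y|a x]; [apply: mulmxDl|rewrite !regular_actE mulmxA].
exists F, (fun c => RngEnd (rmul_lin c)) => [f|c]; last by apply: mul1mx.
by apply: rngEnd_ext => x; rewrite /= -fE.
Qed.

(** d f(x) = \adj psi * f(x) = f(\adj psi * x) = f(d x)
    = f((x \adj psi) * 1) = (x \adj psi) * f(1) = d x f(1). *)
Lemma End_regular_of_det : ~ zero_divisor (\det psi) ->
  ring_isomorphic (rngEnd (rng_regular J)) 'M[B]_n.
Proof.
move=> regd; apply: End_regular_iso => f x.
have fZ := (rngEndP f).2.
have dE : \det psi *: (f x : 'M[B]_n) = \det psi *: (x *m (f (1%:M : 'M[B]_n) : 'M[B]_n)).
  rewrite -mul_scalar_mx -mul_adj_mx -regular_actE -fZ regular_actE.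
  rewrite mul_adj_mx -scalar_mxC -mul_adj_mx mulmxA -[X in f X]mulmx1 -regular_actE fZ.
  by rewrite regular_actE -(mulmxA x) mul_adj_mx -mulmxA mul_scalar_mx -scalemxAr.
apply/matrixP => i j; apply/eqP; rewrite -subr_eq0; apply/eqP.
apply: (nonzero_divisorP regd); rewrite mulrBr.
by have /matrixP/(_ i j) := dE; rewrite !mxE => ->; rewrite subrr.
Qed.

(** The identity matrix, which need not be a unit of J, as a sum of products
    in J; this is the form in which idempotency is used. *)
Definition unit_decomposition (s : seq ('M[B]_n * 'M[B]_n)) : Prop :=
  \sum_(yz <- s) yz.1 *m psi *m yz.2 = 1%:M.

Lemma idempotent_unit_decomposition :
  idempotent_rng J -> exists s, unit_decomposition s.
Proof.
move=> idJ.
pose D : set J := [set a | exists s : seq ('M[B]_n * 'M[B]_n),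
  a = \sum_(yz <- s) yz.1 *m psi *m yz.2].
have: rng_setmul [set: J] [set: J] `<=` D.
  apply: rng_setmul_sub => [|a c _ _]; last first.
    by exists [:: (a, c)]; rewrite big_seq1.
  split; first by exists [::]; rewrite big_nil.
  move=> _ _ [s ->] [t ->]; exists (s ++ [seq (- yz.1, yz.2) | yz <- t]).
  rewrite big_cat big_map /= -sumrN; congr (_ + _); apply: eq_bigr => yz _.
  by rewrite !mulNmx.
by rewrite idJ => /(_ (1%:M : 'M[B]_n) I)[s sE]; exists s; apply: esym.
Qed.

Section UnitDecomposition.
Context (s : seq ('M[B]_n * 'M[B]_n)) (s1 : unit_decomposition s).

Lemma unit_decomposition_mul (x y : 'M[B]_n) :
  x *m y = \sum_(yz <- s) x *m yz.1 *m psi *m (yz.2 *m y).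
Proof.
rewrite -{1}[x]mulmx1 -s1 mulmx_sumr mulmx_suml.
by apply: eq_bigr => yz _; rewrite !mulmxA.
Qed.

Lemma unit_decomposition_fg : left_finitely_generated J.
Proof.
exists [seq (yz.2 : J) | yz <- s]; apply/seteqP; split=> // x _.
rewrite -[x]mulmx1 (unit_decomposition_mul (x : 'M[B]_n)) big_seq.
apply: addsubgroup_sum; first exact: addsubgroup_addspan.
move=> yz yzs; rewrite mulmx1; apply: mem_addspan; exists (yz.2 : J).
  by rewrite /= map_f.
exact: (@mem_rng_setmul J setT [set (yz.2 : J)] ((x : 'M_n) *m yz.1) yz.2).
Qed.

Lemma End_regular_of_unit_decomposition :
  ring_isomorphic (rngEnd (rng_regular J)) 'M[B]_n.
Proof.
apply: End_regular_iso => f x; have [fD fZ] := rngEndP f.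
have f0 : f 0 = 0 by apply: (addIr (f 0)); rewrite -fD !add0r.
have fE y : f y = \sum_(yz <- s) (y : 'M[B]_n) *m yz.1 *m psi *m (f yz.2 : 'M[B]_n).
  rewrite -[y in LHS](mulmx1 (y : 'M[B]_n)) (unit_decomposition_mul (y : 'M[B]_n)).
  rewrite (big_morph f fD f0); apply: eq_bigr => yz _.
  by rewrite mulmx1 -regular_actE fZ.
rewrite (fE (1%:M : 'M_n)) fE mulmx_sumr; apply: eq_bigr => yz _.
by rewrite mul1mx !mulmxA.
Qed.
End UnitDecomposition.
End Endomorphisms.

(** * Endomorphisms of a column *)

Section ColumnEndomorphisms.
Context (B : comPzRingType) (n : nat) (psi : 'M[B]_n) (j0 : 'I_n).
Local Notation J := (gmatrix psi : rngType).
Local Notation Delta := (column_module psi j0).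

Lemma column_pred_delta (a : 'M[B]_n) : a *m delta_mx j0 j0 = a ->
  (a : J) \in column_pred j0.
Proof.
move=> aE; apply/asboolP; exists (fun i => a i j0); rewrite -{1}aE.
rewrite {1}(matrix_sum_delta a) mulmx_suml; apply: eq_bigr => i _.
rewrite mulmx_suml (bigD1 j0) //= big1 ?addr0 => [|j jj0].
  by rewrite -scalemxAl mul_delta_mx.
by rewrite -scalemxAl mul_delta_mx_0 ?scaler0.
Qed.

Lemma column_val_delta (x : Delta) :
  (column_val x : 'M[B]_n) *m delta_mx j0 j0 = (column_val x : 'M[B]_n).
Proof.
case: x => x /= /asboolP[b ->]; rewrite mulmx_suml; apply: eq_bigr => i _.
by rewrite -scalemxAl mul_delta_mx.
Qed.

Lemma column_unit_proof : (delta_mx j0 j0 : J) \in column_pred j0.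
Proof. by apply: column_pred_delta; rewrite mul_delta_mx. Qed.

Definition column_unit : Delta := ColumnModule column_unit_proof.

Lemma column_mul_proof (a : 'M[B]_n) (x : Delta) :
  (a *m (column_val x : 'M[B]_n) : J) \in column_pred j0.
Proof. by apply: column_pred_delta; rewrite -mulmxA column_val_delta. Qed.

Definition column_mul a x : Delta := ColumnModule (column_mul_proof a x).

Lemma column_scale_linear (b : B) : @rng_linear J Delta (column_mul b%:M).
Proof.
split=> [x y|a x]; apply: val_inj => /=; first exact: mulmxDr.
by rewrite !gmatrixE mulmxA -scalar_mxC -!mulmxA -(scalar_mxC b) !mulmxA.
Qed.

Lemma column_corner (x : Delta) i j :
  (column_val x : 'M[B]_n) i j = (column_val x : 'M[B]_n) i j0 *+ (j == j0).
Proof. by case: x => x /= /asboolP[b ->]; rewrite !in_column_entry eqxx. Qed.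

(** Let E be the matrix unit at (j0, j0).  A column x satisfies x E = x, so
    x = \sum_t (x y_t) * (z_t E), whence
    f(x) = x C for a matrix C that depends on f only.  As x and C live in the
    same column, x C is x times the corner entry of C.  Commutativity of B
    makes the order of composition immaterial. *)
Lemma End_column_iso_of_unit_decomposition (s : seq ('M[B]_n * 'M[B]_n)) :
  unit_decomposition psi s -> ring_isomorphic (rngEnd Delta) B.
Proof.
move=> s1.
have fE (f : rngEnd Delta) : exists b, forall x, f x = column_mul b%:M x.
  have [fD fZ] := rngEndP f.
  have f0 : f 0 = 0 by apply: (addIr (f 0)); rewrite -fD !add0r.
  pose C : 'M[B]_n := \sum_(yz <- s) yz.1 *m psi *m
    (column_val (f (column_mul yz.2 column_unit)) : 'M[B]_n).
  have fC x : column_val (f x) = (column_val x : 'M[B]_n) *m C :> 'M[B]_n.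
    have xE : x = \sum_(yz <- s) rngact ((column_val x : 'M[B]_n) *m yz.1 : J)
        (column_mul yz.2 column_unit).
      apply: val_inj; rewrite raddf_sum /= -[LHS]column_val_delta.
      by rewrite (unit_decomposition_mul s1); apply: eq_bigr.
    rewrite {1}xE (big_morph f fD f0) mulmx_sumr -[LHS]/(val _) raddf_sum.
    by apply: eq_bigr => yz _; rewrite fZ /= gmatrixE !mulmxA.
  have CE j : C j0 j = C j0 j0 *+ (j == j0).
    rewrite /C !summxE -sumrMnl; apply: eq_bigr => yz _.
    rewrite [LHS]mxE [in RHS]mxE -sumrMnl; apply: eq_bigr => k _.
    by rewrite column_corner mulrnAr.
  exists (C j0 j0) => x; apply: val_inj => /=; rewrite fC mul_scalar_mx.
  apply/matrixP => i j; rewrite !mxE (bigD1 j0) //= big1 ?addr0 => [|k kj0].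
    by rewrite (CE j) (column_corner x i j) !mulrnAr mulrC.
  by rewrite column_corner (negPf kj0) mul0r.
pose ev (f : rngEnd Delta) : B := (column_val (f column_unit) : 'M[B]_n) j0 j0.
have ev_mul (f : rngEnd Delta) b : (forall x, f x = column_mul b%:M x) -> ev f = b.
  by move=> fb; rewrite /ev fb /= mul_scalar_mx !mxE !eqxx mulr1.
have evE (f : rngEnd Delta) x : f x = column_mul (ev f)%:M x.
  by have [b fb] := fE f; rewrite fb (ev_mul f b fb).
have evB : zmod_morphism ev by move=> f g; rewrite /ev /= !mxE.
have evM : monoid_morphism ev.
  split; first by rewrite /ev /= mxE !eqxx.
  move=> f g; apply: ev_mul => x; rewrite -[LHS]/(g (f x)) (evE g) (evE f).
  apply: val_inj => /=.
  by rewrite mulmxA -scalar_mxM mulrC.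
pose F : {rmorphism rngEnd Delta -> B} := HB.pack ev
  (GRing.isZmodMorphism.Build _ _ ev evB) (GRing.isMonoidMorphism.Build _ _ ev evM).
exists F, (fun b => RngEnd (column_scale_linear b)) => [f|b]; last exact: ev_mul.
by apply: rngEnd_ext => x; rewrite /= -evE.
Qed.
End ColumnEndomorphisms.

(** * Idempotency and generators *)

Section IdealsAndGenerators.
Context (B : comPzRingType) (n : nat) (psi : 'M[B]_n).
Local Notation J := (gmatrix psi : rngType).
Local Notation I := (entries_ideal psi).

Lemma ideal_set_gen (G : set B) : ideal_set (ideal_gen G).
Proof.
split=> [A [[A0 _ _] _] //|x y Gx Gy A [iA GA]|b x Gx A [iA GA]].
  by case: (iA) => _ AD _; apply: AD; [apply: Gx|apply: Gy].
by case: (iA) => _ _ AM; apply: AM; apply: Gx.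
Qed.

Lemma ideal_set_sum (A : set B) (T : Type) (r : seq T) (F : T -> B) :
  ideal_set A -> (forall i, A (F i)) -> A (\sum_(i <- r) F i).
Proof. by case=> A0 AD _ AF; elim/big_ind: _ => // x y; apply: AD. Qed.

Lemma entries_ideal_entry i j : I (psi i j).
Proof. by apply: sub_gen_smallest; exists (i, j). Qed.

Let unit_span : set J := addsum [set: 'I_n * 'I_n]
  (fun ij => left_multiples (matrix_unit psi ij.1 ij.2)).

Lemma unit_span_sub : unit_span `<=` rng_setmul [set: J] [set: J].
Proof.
apply: addspan_sub => [|x [ij _]]; first exact: addsubgroup_addspan.
apply: rng_setmul_sub => [|a c _ _]; first exact: addsubgroup_addspan.
exact: mem_rng_setmul.
Qed.

Lemma setmul_sub_matrices_over :
  rng_setmul [set: J] [set: J] `<=` (matrices_over I : set J).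
Proof.
have idI : ideal_set I by apply: ideal_set_gen.
have [I0 ID IM] := idI.
apply: rng_setmul_sub => [|a c _ _ i j].
  split=> [i j|x y Mx My i j]; first by rewrite mxE.
  by rewrite !mxE -mulN1r; apply: (ID _ _ (Mx i j)); exact: (IM _ _ (My i j)).
rewrite gmatrixE mxE; apply: (ideal_set_sum _ idI) => k; rewrite mxE mulrC.
apply: (IM); apply: (ideal_set_sum _ idI) => l.
by apply: (IM); apply: entries_ideal_entry.
Qed.

(** The c such that all b c E_ij lie in the span form an ideal of B (the factor
    b is there to make it one), and it contains the entries of psi because
    b psi_pq E_ij = (b E_ip) * E_qj. *)
Lemma matrices_over_sub_unit_span : (matrices_over I : set J) `<=` unit_span.
Proof.
have spanD := addsubgroup_addspan
  (\bigcup_(ij in [set: 'I_n * 'I_n]) left_multiples (matrix_unit psi ij.1 ij.2)).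
have IE c : I c -> forall b i j, unit_span ((b * c) *: delta_mx i j : 'M_n).
  move: c; apply: smallest_sub.
    split=> [b i j|x y Ix Iy b i j|c x Ix b i j].
    - by rewrite mulr0 scale0r; case: spanD.
    - by rewrite mulrDr scalerDl; apply: (addsubgroupD spanD); [apply: Ix|apply: Iy].
    - by rewrite mulrA; apply: Ix.
  move=> _ [[p q] _ <-] b i j; apply: mem_addspan; exists (q, j) => //=.
  have := @mem_rng_setmul J setT [set (matrix_unit psi q j)]
    (b *: delta_mx i p : 'M_n) (matrix_unit psi q j) Logic.I erefl.
  rewrite gmatrixE /matrix_unit -!scalemxAl.
  by rewrite delta_mx_corner scalerA.
move=> a aI; rewrite (matrix_sum_delta (a : 'M[B]_n)).
apply: addsubgroup_sum => // i _; apply: addsubgroup_sum => // j _.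
by have := IE _ (aI i j) 1 i j; rewrite mul1r.
Qed.

Lemma setmul_unit_span : rng_setmul [set: J] [set: J] = unit_span.
Proof.
apply/seteqP; split; last exact: unit_span_sub.
exact: subset_trans setmul_sub_matrices_over matrices_over_sub_unit_span.
Qed.

Lemma setmul_matrices_over :
  rng_setmul [set: J] [set: J] = (matrices_over I : set J).
Proof.
apply/seteqP; split; first exact: setmul_sub_matrices_over.
exact: subset_trans matrices_over_sub_unit_span unit_span_sub.
Qed.

Lemma idempotent_rngE : (0 < n)%N -> idempotent_rng J <-> I = setT.
Proof.
move=> n_gt0; rewrite /idempotent_rng setmul_matrices_over; split=> [MT|IT].
  apply/seteqP; split=> // b _.
  have : (matrices_over I : set J) (const_mx b : 'M_n) by rewrite MT.
  by move=> /(_ (Ordinal n_gt0) (Ordinal n_gt0)); rewrite mxE.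
by apply/seteqP; split=> // a _ i j; rewrite IT.
Qed.

(** The identity matrix is a multiple a psi e of the generator; take
    determinants. *)
Lemma left_generator_invertible (e : J) : left_generator e -> invertible (\det psi).
Proof.
move=> Je.
have [a aE] : exists a : 'M[B]_n, a *m psi *m (e : 'M[B]_n) = 1%:M.
  have: left_multiples e `<=` [set c | exists a : 'M[B]_n, c = a *m psi *m (e : 'M[B]_n)].
    apply: rng_setmul_sub => [|a c _ ->]; last by exists a.
    split; first by exists 0; rewrite !mul0mx.
    by move=> _ _ [a ->] [b ->]; exists (a - b); rewrite !mulmxBl.
  by rewrite Je => /(_ (1%:M : 'M_n) Logic.I)[a aE]; exists a; rewrite -aE.
exists (\det a * \det (e : 'M[B]_n)).
by rewrite mulrA [_ * \det a]mulrC -!det_mulmx aE det1.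
Qed.

(** The inverse of psi is a two-sided unit of J. *)
Lemma invertible_central_generator : invertible (\det psi) ->
  exists e : J, [/\ idempotent_elt e, central e & left_generator e].
Proof.
case=> u du; pose e : 'M[B]_n := u *: \adj psi.
have eL : psi *m e = 1%:M.
  by rewrite /e -scalemxAr mul_mx_adj scale_scalar_mx mulrC du.
have eR : e *m psi = 1%:M.
  by rewrite /e -scalemxAl mul_adj_mx scale_scalar_mx mulrC du.
exists e; split.
- by rewrite /idempotent_elt gmatrixE eR mul1mx.
- by move=> a; rewrite !gmatrixE eR mul1mx -mulmxA eL mulmx1.
apply/seteqP; split=> // a _.
have := @mem_rng_setmul J setT [set (e : J)] a e Logic.I erefl.
by rewrite gmatrixE -mulmxA eL mulmx1.
Qed.
End IdealsAndGenerators.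

(* The k-algebra structure of B is the ring morphism iota
   (comAlgType would exclude the zero algebra). *)
Theorem proposition2p5 (k : comPzRingType) (k_noeth : noetherian k)
    (B : comPzRingType) (iota : {rmorphism k -> B})
    (n : nat) (n_gt0 : (0 < n)%N) (psi : 'M[B]_n) :
  let J : rngType := gmatrix psi in
  let I : set B := entries_ideal psi in
  let Delta : rngModType J := column_module psi (Ordinal n_gt0) in
  (* (1) *)
  (satisfies J (standard_poly n.*2 ^+ 2) /\
   monic_ncpoly (standard_poly n.*2 ^+ 2)) /\
  (* (2) *)
  (semiprime J <-> reduced B /\ ~ zero_divisor (\det psi)) /\
  (* (3) *)
  central (\adj psi : J) /\
  (* (4) *)
  (~ zero_divisor (\det psi) ->
     ring_isomorphic (rngEnd (rng_regular J)) 'M[B]_n) /\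
  (* (5) *)
  (rng_setmul [set: J] [set: J] =
     addsum [set: 'I_n * 'I_n]
       (fun ij => left_multiples (matrix_unit psi ij.1 ij.2)) /\
   rng_setmul [set: J] [set: J] = (matrices_over I : set J)) /\
  (* (6) *)
  ((idempotent_rng J <-> I = setT) /\
   (idempotent_rng J ->
      [/\ left_finitely_generated J,
          ring_isomorphic (rngEnd (rng_regular J)) 'M[B]_n
        & ring_isomorphic (rngEnd Delta) B])) /\
  (* (7) *)
  [<-> exists e : J, idempotent_elt e /\ left_generator e;
       exists e : J, [/\ idempotent_elt e, central e & left_generator e];
       exists e : J, left_generator e;
       invertible (\det psi)].
Proof.
move=> J I Delta; split.
  by split; [apply: satisfies_standard_poly_sqr|apply: monic_standard_poly_sqr].
split.
  split=> [sp|[redB regd]]; last exact: reduced_regular_semiprime.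
  by split; [apply: semiprime_reduced sp|apply: semiprime_regular sp].
split; first exact: adj_central.
split; first exact: End_regular_of_det.
split; first by split; [apply: setmul_unit_span|apply: setmul_matrices_over].
split.
  split=> [|/idempotent_unit_decomposition[s s1]]; first exact: idempotent_rngE.
  split; first exact: unit_decomposition_fg s1.
    exact: End_regular_of_unit_decomposition s1.
  exact: End_column_iso_of_unit_decomposition s1.
tfae.
- by case=> e [_ /left_generator_invertible]; apply: invertible_central_generator.
- by case=> e [_ _ eJ]; exists e.
- by case=> e; apply: left_generator_invertible.
- by case/invertible_central_generator=> e [ee _ eJ]; exists e.
Qed.
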